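(* Let $A\in\mathbb{R}^{n\times n}$ be invertible, $c\in\mathbb{R}^n$, and $Q=\{(x,t)\in\mathbb{R}^{n+1}:\|A(x-c)\|_2^2\le t\}$. Let $k\ge 1$, let $\pi_1,\dots,\pi_k\in\mathbb{R}^n\setminus\{0\}$ satisfy $A^{-T}\pi_i\perp A^{-T}\pi_j$ for all $i\neq j$, let $\pi_0^i<\pi_1^i$ be real for $i\in[k]$, and let $$F=\bigcup_{i=1}^k\{(x,t)\in\mathbb{R}^{n+1}:\pi_0^i\le\pi_i^Tx\le\pi_1^i\}.$$ For $i\in[k]$ let $a_i=\frac{\pi_0^i+\pi_1^i-2\pi_i^Tc}{\|A^{-T}\pi_i\|_2^2}$ and $b_i=-\frac{(\pi_1^i-\pi_i^Tc)(\pi_0^i-\pi_i^Tc)}{\|A^{-T}\pi_i\|_2^2}$, and for $\mathcal{I}\subseteq[k]$ let $$h_{\mathcal{I}}(x)=\Bigl\|\Bigl(A-\sum_{i\in\mathcal{I}}\frac{A^{-T}\pi_i\pi_i^T}{\|A^{-T}\pi_i\|_2^2}\Bigr)(x-c)\Bigr\|_2^2+\sum_{i\in\mathcal{I}}\bigl(a_i\pi_i^T(x-c)+b_i\bigr).$$ Then $$\mathrm{conv}\bigl(Q\setminus \mathrm{int}(F)\bigr)=Q\cap C,\qquad C=\Bigl\{(x,t)\in\mathbb{R}^{n+1}:\max_{\mathcal{I}\subseteq[k]}h_{\mathcal{I}}(x)\le t\Bigr\}.$$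
   Context: $[k]=\{1,\dots,k\}$ and $A^{-T}=(A^{-1})^T$. $\mathrm{int}$ is the topological interior and $\mathrm{conv}$ the convex hull. *)

(* Defs.v *)
From mathcomp Require Import all_boot all_order all_algebra.
From mathcomp Require Import all_classical all_reals all_analysis.

Set Implicit Arguments.
Unset Strict Implicit.
Unset Printing Implicit Defensive.

Import Order.TTheory GRing.Theory Num.Theory.
Import numFieldNormedType.Exports.

Local Open Scope classical_set_scope.
Local Open Scope ring_scope.

Definition convex_hull (R : realType) (E : lmodType R) (S : set E) : set E :=
  smallest (@convex_set R E) S.

Definition dot (R : realType) (n : nat) (u v : 'cV[R]_n) : R :=
  (u^T *m v) ord0 ord0.

(* The norm `|v| of the library on 'cV[R]_n is the sup norm. *)
Definition norm2 (R : realType) (n : nat) (v : 'cV[R]_n) : R :=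
  Num.sqrt (\sum_i v i ord0 ^+ 2).

(* R^(n+1) is the product of R^n and R: z.1 is x and z.2 is t, with the product
   topology. R^o is R as a module over itself, needed for the convex hull. *)
Section Paraboloid.
Context {R : realType} {n k : nat}.
Variables (A : 'M[R]_n) (c : 'cV[R]_n).
Variables (p : 'I_k -> 'cV[R]_n) (p0 p1 : 'I_k -> R).

Definition paraboloid : set ('cV[R]_n * R^o) :=
  [set z | norm2 (A *m (z.1 - c)) ^+ 2 <= z.2].

Definition split_union : set ('cV[R]_n * R^o) :=
  \bigcup_(i in [set: 'I_k]) [set z | p0 i <= dot (p i) z.1 <= p1 i].

Definition invT : 'M[R]_n := (invmx A)^T.

Definition cut_a (i : 'I_k) : R :=
  (p0 i + p1 i - 2 * dot (p i) c) / norm2 (invT *m p i) ^+ 2.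

Definition cut_b (i : 'I_k) : R :=
  - ((p1 i - dot (p i) c) * (p0 i - dot (p i) c) / norm2 (invT *m p i) ^+ 2).

Definition cut_h (I : {set 'I_k}) (x : 'cV[R]_n) : R :=
  norm2 ((A - \sum_(i in I)
            (norm2 (invT *m p i) ^+ 2)^-1 *: (invT *m p i *m (p i)^T))
         *m (x - c)) ^+ 2
  + \sum_(i in I) (cut_a i * dot (p i) (x - c) + cut_b i).

(* The maximum runs over a nonempty family, so its default value at set0
   is one of the values being compared. *)
Definition cut_set : set ('cV[R]_n * R^o) :=
  [set z | \big[Num.max/cut_h finset.set0 z.1]_(I : {set 'I_k}) cut_h I z.1 <= z.2].

End Paraboloid.

(* Main.v *)
(* With q_i = A^{-T} pi_i, orthogonality of the q_i turns h_I into
   |A(x - c)|^2 + sum_{i in I} g_i(x), where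
   g_i(x) = (pi_1^i - pi_i^T x)(pi_i^T x - pi_0^i) / |q_i|^2. As originally
   written each h_I is a convex quadratic, so C is convex, and outside int F all
   g_i are nonpositive; hence conv(Q \ int F) lies in C. Conversely, a point of C
   strictly inside the split i is a convex combination of two points on the two
   facets of that split, obtained by moving x along A^{-1} q_i; these points stay
   in C and orthogonality leaves the other pi_j^T x unchanged. Doing this for each
   split in turn reaches points of Q \ int F. *)
Require Import Defs.
From mathcomp Require Import all_boot all_order all_algebra.
From mathcomp Require Import all_classical all_reals all_analysis.
From mathcomp Require Import ring lra.

Set Implicit Arguments.
Unset Strict Implicit.
Unset Printing Implicit Defensive.

Import Order.TTheory GRing.Theory Num.Theory.
Import numFieldNormedType.Exports.

Local Open Scope classical_set_scope.
Local Open Scope ring_scope.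

(** * Euclidean inner product and norm *)

Section DotProduct.
Context {R : realType} {n : nat}.
Implicit Types (u v w : 'cV[R]_n) (M : 'M[R]_n).

Lemma dotE u v : dot u v = \sum_i u i ord0 * v i ord0.
Proof. by rewrite /dot mxE; apply: eq_bigr => i _; rewrite mxE. Qed.

Lemma dotC u v : dot u v = dot v u.
Proof. by rewrite !dotE; apply: eq_bigr => i _; rewrite mulrC. Qed.

Lemma dotDr u v w : dot u (v + w) = dot u v + dot u w.
Proof. by rewrite /dot mulmxDr mxE. Qed.

Lemma dotZr u a v : dot u (a *: v) = a * dot u v.
Proof. by rewrite /dot -scalemxAr mxE. Qed.

Lemma dotBr u v w : dot u (v - w) = dot u v - dot u w.
Proof. by rewrite -scaleN1r dotDr dotZr mulN1r. Qed.

Lemma dot_sumr (I : finType) (P : pred I) u (F : I -> 'cV[R]_n) :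
  dot u (\sum_(i | P i) F i) = \sum_(i | P i) dot u (F i).
Proof. by rewrite /dot mulmx_sumr summxE. Qed.

Lemma dot_mulmx u M v : dot u (M *m v) = dot (M^T *m u) v.
Proof. by rewrite /dot trmx_mul trmxK mulmxA. Qed.

Lemma sqr_norm2 v : norm2 v ^+ 2 = dot v v.
Proof.
rewrite /norm2 sqr_sqrtr ?dotE; first by apply: eq_bigr => i _; rewrite expr2.
by apply: sumr_ge0 => i _; exact: sqr_ge0.
Qed.

Lemma sqr_norm2D u v :
  norm2 (u + v) ^+ 2 = norm2 u ^+ 2 + 2 * dot u v + norm2 v ^+ 2.
Proof.
rewrite !sqr_norm2 dotDr dotC dotDr (dotC (u + v)) dotDr (dotC v u).
by rewrite mulr2n mulrDl mul1r !addrA.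
Qed.

Lemma sqr_norm2Z a v : norm2 (a *: v) ^+ 2 = a ^+ 2 * norm2 v ^+ 2.
Proof. by rewrite !sqr_norm2 dotZr dotC dotZr mulrA expr2. Qed.

Lemma sqr_norm2_ge0 v : 0 <= norm2 v ^+ 2.
Proof. exact: sqr_ge0. Qed.

Lemma sqr_norm2_gt0 v : (0 < norm2 v ^+ 2) = (v != 0).
Proof.
rewrite lt_neqAle sqr_ge0 andbT eq_sym; congr negb; apply/eqP/eqP => [|->].
  rewrite sqr_norm2 dotE => /psumr_eq0P v0; apply/matrixP => i j.
  rewrite ord1 mxE; apply/eqP; rewrite -sqrf_eq0 expr2.
  by rewrite v0// => {}i _; rewrite -expr2 sqr_ge0.
by rewrite sqr_norm2 /dot mulmx0 mxE.
Qed.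

(** The right side exceeds the left by a (1 - a) |u - v|^2. *)
Lemma norm2_conv (a : R) u v : 0 <= a <= 1 ->
  norm2 (a *: u + (1 - a) *: v) ^+ 2 <=
  a * norm2 u ^+ 2 + (1 - a) * norm2 v ^+ 2.
Proof.
move=> /andP[a0 a1]; rewrite sqr_norm2D !sqr_norm2Z dotC dotZr dotC dotZr.
have := sqr_norm2_ge0 (u + (-1) *: v).
rewrite sqr_norm2D sqr_norm2Z dotZr => uv0.
have : 0 <= a * (1 - a) * (norm2 u ^+ 2 + 2 * (-1 * dot u v) + (-1) ^+ 2 * norm2 v ^+ 2).
  by rewrite !mulr_ge0// subr_ge0.
by rewrite -subr_ge0 => h; rewrite -subr_ge0; apply: le_trans h _; lra.
Qed.

Lemma dot_continuous u : continuous (dot u : 'cV[R]_n -> R^o).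
Proof.
have -> : (dot u : _ -> R^o) = fun v => \sum_i u i ord0 * v i ord0.
  by apply/funext => v; rewrite dotE.
move=> v; apply: (@cvg_big _ _ +%R 0 _ add_continuous _ (nbhs v)) => i _.
by apply: cvgMl_tmp; exact: coord_continuous.
Qed.

End DotProduct.

Lemma convex_set_comb (R : realType) (E : lmodType R) (M : set E) (a : R)
    (x y : E) : @convex_set R E M -> 0 <= a <= 1 -> M x -> M y ->
  M (a *: x + (1 - a) *: y).
Proof.
move=> Mconv /andP[a0 a1] Mx My.
have := Mconv x y (Itv01 a0 a1) (mem_set Mx) (mem_set My).
by rewrite inE.
Qed.

(** * The cuts: gap form and convexity *)

Section SplitCuts.
Context {R : realType} {n k : nat}.
Variables (A : 'M[R]_n) (c : 'cV[R]_n).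
Variables (p : 'I_k -> 'cV[R]_n) (p0 p1 : 'I_k -> R).
Hypothesis hA : A \in unitmx.
Hypothesis hp : forall i, p i != 0.
Hypothesis horth : forall i j, i != j -> dot (invT A *m p i) (invT A *m p j) = 0.
Hypothesis hlt : forall i, p0 i < p1 i.

Let q i := invT A *m p i.
Let N i := norm2 (q i) ^+ 2.

Lemma invTK i : A^T *m q i = p i.
Proof. by rewrite mulmxA -trmx_mul mulVmx// trmx1 mul1mx. Qed.

Lemma sqr_norm2_invT_gt0 i : 0 < N i.
Proof.
rewrite /N sqr_norm2_gt0; apply: contra_neq (hp i) => q0.
by rewrite -invTK q0 mulmx0.
Qed.

Lemma dot_invT i v : dot (q i) (A *m v) = dot (p i) v.
Proof. by rewrite dot_mulmx invTK. Qed.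

(** Orthogonality of the [q i] makes these directions dual to the [p i] up to scaling, so each form
    [dot (p i)] can be moved independently of the others. *)
Definition normal_dir i : 'cV[R]_n := invmx A *m q i.

Lemma mulmx_normal_dir i : A *m normal_dir i = q i.
Proof. by rewrite mulKVmx. Qed.

Lemma dot_normal_dir i j :
  dot (p i) (normal_dir j) = if i == j then N i else 0.
Proof.
rewrite -dot_invT mulmx_normal_dir; case: eqVneq => [<-|/horth//].
by rewrite /N sqr_norm2.
Qed.

Definition slab_gap i (x : 'cV[R]_n) : R :=
  (p1 i - dot (p i) x) * (dot (p i) x - p0 i) / N i.

(** The matrix sum subtracts from A(x - c) its orthogonal projection onto the span of the [q i], i
    in I. By Pythagoras this removes the sum of [l i ^+ 2 / N i], which completes
    [cut_a i * l i + cut_b i] to the factored quadratic [slab_gap i x]. *)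
Lemma cut_hE (I : {set 'I_k}) x :
  cut_h A c p p0 p1 I x =
  norm2 (A *m (x - c)) ^+ 2 + \sum_(i in I) slab_gap i x.
Proof.
have N0 i : N i != 0 by rewrite gt_eqF// sqr_norm2_invT_gt0.
rewrite /cut_h mulmxBl mulmx_suml.
pose l i := dot (p i) (x - c).
have projE : \sum_(i in I)
    ((norm2 (invT A *m p i) ^+ 2)^-1 *: (invT A *m p i *m (p i)^T)) *m (x - c)
    = \sum_(i in I) (l i / N i) *: q i.
  apply: eq_bigr => i _; rewrite -/(q i) -/(N i) -scalemxAl -(mulmxA (q i)).
  rewrite [(p i)^T *m _]mx11_scalar mul_mx_scalar scalerA mulrC.
  by [].
rewrite {}projE -[X in norm2 (_ + X)]scaleN1r sqr_norm2D sqr_norm2Z dotZr.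
have -> : dot (A *m (x - c)) (\sum_(i in I) (l i / N i) *: q i) =
    \sum_(i in I) l i ^+ 2 / N i.
  rewrite dot_sumr; apply: eq_bigr => i _.
  by rewrite dotZr dotC dot_invT -/(l i); ring.
have -> : norm2 (\sum_(i in I) (l i / N i) *: q i) ^+ 2 =
    \sum_(i in I) l i ^+ 2 / N i.
  rewrite sqr_norm2 dot_sumr; apply: eq_bigr => i iI.
  rewrite dotZr dotC dot_sumr (bigD1 i)//= big1 => [|j /andP[_ ji]].
    by rewrite addr0 dotZr -sqr_norm2 -/(N i); field.
  by rewrite dotZr horth 1?eq_sym// mulr0.
rewrite [LHS](_ : _ = norm2 (A *m (x - c)) ^+ 2 +
  (\sum_(i in I) (cut_a A c p p0 p1 i * l i + cut_b A c p p0 p1 i) -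
   \sum_(i in I) l i ^+ 2 / N i)); last by rewrite /l; ring.
rewrite -sumrB; congr (_ + _).
apply: eq_bigr => i _; rewrite /slab_gap /cut_a /cut_b -/(q i) -/(N i) /l dotBr.
by field.
Qed.

Lemma cut_setE z : cut_set A c p p0 p1 z <->
  forall I, cut_h A c p p0 p1 I z.1 <= z.2.
Proof.
split=> [/bigmax_leP[_ h] I|h]; first exact: h.
by apply/bigmax_leP; split=> [|I _]; exact: h.
Qed.

Lemma cut_set_sub_paraboloid :
  cut_set A c p p0 p1 `<=` paraboloid A c.
Proof. by move=> z /cut_setE/(_ finset.set0); rewrite cut_hE big_set0 addr0. Qed.

(** The original form is used here, a squared norm of an affine map plus an affine function; in the
    gap form the concave gaps would hide convexity. *)
Lemma cut_h_conv (I : {set 'I_k}) (a : R) (x y : 'cV[R]_n) : 0 <= a <= 1 ->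
  cut_h A c p p0 p1 I (a *: x + (1 - a) *: y) <=
  a * cut_h A c p p0 p1 I x + (1 - a) * cut_h A c p p0 p1 I y.
Proof.
move=> a01; have xyc : a *: x + (1 - a) *: y - c =
    a *: (x - c) + (1 - a) *: (y - c).
  by rewrite !scalerBr addrACA -opprD -scalerDl subrKC scale1r.
rewrite /cut_h xyc mulmxDr -!scalemxAr !mulrDr addrACA.
apply: lerD; first exact: norm2_conv.
rewrite !mulr_sumr -big_split/=; apply: ler_sum => i _.
by rewrite [dot _ (_ *: _ + _)]dotDr !dotZr le_eqVlt; apply/orP; left; apply/eqP; ring.
Qed.

Lemma convex_cut_set :
  @convex_set R ('cV[R]_n * R^o)%type (cut_set A c p p0 p1).
Proof.
move=> x y a /set_mem/cut_setE hx /set_mem/cut_setE hy.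
apply/mem_set/cut_setE => I.
have a01 : 0 <= a%:num <= 1 by rewrite ge0 le1.
apply: le_trans (cut_h_conv I x.1 y.1 a01) _.
by apply: lerD; apply: ler_wpM2l => //; rewrite ?subr_ge0 ?(andP a01).1 ?(andP a01).2.
Qed.

(** * Interior of the union of splits *)

(** A union of closed slabs may have interior points lying in no open slab, for instance where
    parallel slabs touch. Orthogonality excludes this: a point in no open slab can leave all closed
    slabs at once by an arbitrarily small move. *)
Lemma interior_split_unionP z :
  interior (split_union p p0 p1) z <->
  exists i, p0 i < dot (p i) z.1 < p1 i.
Proof.
split=> [zF|[i /andP[lo hi]]]; last first.
  have pz : (fun w : 'cV[R]_n * R^o => dot (p i) w.1 : R^o) @ z -->
      (dot (p i) z.1 : R^o).
    apply: (@cvg_comp _ _ _ fst (dot (p i) : _ -> R^o) _ (nbhs z.1)).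
      exact: cvg_fst.
    exact: dot_continuous.
  rewrite /interior/=; near=> w; exists i => //=.
  apply/andP; split; apply: ltW; near: w.
    exact: cvgr_gt pz _ lo.
  exact: cvgr_lt pz _ hi.
apply: contrapT => /forallNP out.
(* The sign pushes the j-th form up when it is at least [p1 j]; otherwise [out] puts it at or below
   [p0 j], and it is pushed down. *)
pose s j : R := if p1 j <= dot (p j) z.1 then 1 else -1.
pose d : 'cV[R]_n := \sum_j s j *: normal_dir j.
have dotd j : dot (p j) d = s j * N j.
  rewrite dot_sumr (bigD1 j)//= big1 => [|i ij].
    by rewrite dotZr dot_normal_dir eqxx addr0.
  by rewrite dotZr dot_normal_dir eq_sym (negPf ij) mulr0.
pose f (e : R^o) : 'cV[R]_n * R^o := (z.1 + e *: d, z.2).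
have zd : (fun e : R^o => z.1 + e *: d) @ (0 : R^o) --> z.1.
  have := @cvgD _ _ _ _ _ (fun=> z.1) (fun e : R^o => e *: d) _ _
    (cvg_cst z.1) (@scalel_continuous _ _ d 0).
  by rewrite scale0r addr0; apply.
have fz : f @ (0 : R^o) --> z.
  by apply: (@cvg_pair _ _ _ _ (nbhs z.1) (nbhs z.2) _ _ _ _ (fun=> z.2) zd);
    exact: cvg_cst.
have {}zF : \forall e \near (0 : R^o), split_union p p0 p1 (f e).
  exact: fz _ zF.
have [e e0 [i _]] : exists2 e : R, 0 < e & split_union p p0 p1 (f e).
  have [r/= r0 rF] := (nbhs_ballP _ _).1 zF.
  exists (r / 2); first by rewrite divr_gt0.
  apply: rF; rewrite /ball/= sub0r normrN gtr0_norm ?divr_gt0//.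
  by rewrite ltr_pdivrMr// ltr_pMr// ltr1n.
have eN : 0 < e * N i by rewrite mulr_gt0// sqr_norm2_invT_gt0.
rewrite /= dotDr dotZr dotd mulrCA /s => /andP[].
case: (leP (p1 i) (dot (p i) z.1)) => hi lo' hi'; first lra.
move: (out i) => /negP; rewrite negb_and -!leNgt.
by move=> /orP[|]; lra.
Unshelve. all: by end_near.
Qed.

(** * Sliding a point to the facets of a split *)

(* At a facet [e] of the split [i] the [i]-th gap vanishes. The new height is
   the old one, less the old [i]-th gap, plus the change of
   [norm2 (A *m (x - c)) ^+ 2]. *)
Definition slide i (e : R) (z : 'cV[R]_n * R^o) : 'cV[R]_n * R^o :=
  let r := (e - dot (p i) z.1) / N i in
  (z.1 + r *: normal_dir i,
   z.2 - slab_gap i z.1 + 2 * r * dot (p i) (z.1 - c) + r ^+ 2 * N i).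

Lemma dot_slide i e z j :
  dot (p j) (slide i e z).1 = if j == i then e else dot (p j) z.1.
Proof.
rewrite /= dotDr dotZr dot_normal_dir; case: eqVneq => [->|_].
  have N0 : N i != 0 by rewrite gt_eqF// sqr_norm2_invT_gt0.
  by rewrite divfK// addrC subrK.
by rewrite mulr0 addr0.
Qed.

Lemma cut_set_slide i e z : (p1 i - e) * (e - p0 i) = 0 ->
  cut_set A c p p0 p1 z -> cut_set A c p p0 p1 (slide i e z).
Proof.
move=> e01 /cut_setE hz; apply/cut_setE => I.
have iD : i \notin (I :\ i)%SET by rewrite finset.setD11.
(* The cut for I at the new point is equivalent to the cut for I with i added at [z]: the height
   drops by the i-th gap. Removing i first covers both i in I and i not in I. *)
have := hz (i |: I :\ i)%SET; rewrite !cut_hE finset.big_setU1//=.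
have -> : \sum_(j in I) slab_gap j (slide i e z).1 =
    \sum_(j in (I :\ i)%SET) slab_gap j z.1.
  rewrite (eq_bigr (fun j => if j != i then slab_gap j z.1 else 0)) => [|j _].
    rewrite -big_mkcondr/=; apply: eq_bigl => j.
    by rewrite finset.in_setD1 andbC.
  rewrite /slab_gap dot_slide; case: eqVneq => [->|//].
  by rewrite e01 mul0r.
have -> : (slide i e z).1 - c =
    (z.1 - c) + ((e - dot (p i) z.1) / N i) *: normal_dir i.
  by rewrite /= addrAC.
rewrite [A *m (_ - _ + _)]mulmxDr -scalemxAr mulmx_normal_dir sqr_norm2D sqr_norm2Z dotZr.
rewrite (dotC (A *m _)) dot_invT -/(N i) /=.
lra.
Qed.

(** The weights make the two displacements average to zero, so the height terms linear in the
    displacement cancel. The quadratic ones average to a two-point variance, which is exactly the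
    gap subtracted in [slide]. *)
Lemma slide_comb i z : let a := (dot (p i) z.1 - p0 i) / (p1 i - p0 i) in
  z = a *: slide i (p1 i) z + (1 - a) *: slide i (p0 i) z.
Proof.
have d0 : p1 i - p0 i != 0 by rewrite subr_eq0 gt_eqF.
have N0 : N i != 0 by rewrite gt_eqF// sqr_norm2_invT_gt0.
case: z => x t; set s := dot (p i) (x, t).1 => a; congr pair.
  have r0 : a * ((p1 i - s) / N i) + (1 - a) * ((p0 i - s) / N i) = 0.
    by rewrite /a; field; rewrite N0 d0.
  change (x = a *: (slide i (p1 i) (x, t)).1 + (1 - a) *: (slide i (p0 i) (x, t)).1).
  rewrite /= -/s !scalerDr !scalerA addrACA -!scalerDl subrKC scale1r.
  by rewrite r0 scale0r addr0.
change (t = a * (slide i (p1 i) (x, t)).2 + (1 - a) * (slide i (p0 i) (x, t)).2).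
by rewrite /slide /slab_gap /a /= -/s; field; rewrite N0 d0.
Qed.

(** The hull is the intersection of all convex supersets, so the hard inclusion is tested against an
    arbitrary one. *)
Lemma cut_set_sub_convex (M : set ('cV[R]_n * R^o)) :
  @convex_set R ('cV[R]_n * R^o)%type M ->
  paraboloid A c `\` interior (split_union p p0 p1) `<=` M ->
  cut_set A c p p0 p1 `<=` M.
Proof.
move=> Mconv SM.
(* Induction on a list [s] of the splits whose open slab may still contain the point; at first it
   lists all of them. *)
suff h (s : seq 'I_k) z : cut_set A c p p0 p1 z ->
    (forall i, i \notin s -> ~~ (p0 i < dot (p i) z.1 < p1 i)) -> M z.
  by move=> z /(h (enum 'I_k)); apply => i; rewrite mem_enum.
elim: s z => [|i s IHs] z zC out.
  apply: SM; split; first exact: cut_set_sub_paraboloid.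
  by move=> /interior_split_unionP[i]; apply/negP; exact: out.
have [/andP[lo hi]|iout] := boolP (p0 i < dot (p i) z.1 < p1 i); last first.
  apply: IHs => // j js; have [->//|ji] := eqVneq j i.
  by apply: out; rewrite inE negb_or ji.
(* Sliding to a facet takes the point out of the open slab i and keeps the other forms, so [s]
   without i suffices. *)
have slideM e : (p1 i - e) * (e - p0 i) = 0 -> M (slide i e z).
  move=> e01; apply: IHs => [|j js]; first exact: cut_set_slide.
  rewrite dot_slide; case: eqVneq => [ji|ji].
    by apply/negP => /andP[]; rewrite ji; nra.
  by apply: out; rewrite inE negb_or ji.
rewrite (slide_comb i z); apply: convex_set_comb => //.
- by rewrite divr_ge0 ?ler_pdivrMr ?subr_ge0 ?subr_gt0 ?mul1r ?lerD2r// ltW.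
- by apply: slideM; rewrite subrr mul0r.
- by apply: slideM; rewrite subrr mulr0.
Qed.

Lemma sub_cut_set :
  paraboloid A c `\` interior (split_union p p0 p1) `<=` cut_set A c p p0 p1.
Proof.
move=> z [zQ zF]; apply/cut_setE => I; rewrite cut_hE.
apply: le_trans zQ; rewrite gerDl; apply: sumr_le0 => i _.
rewrite /slab_gap ler_pdivrMr ?sqr_norm2_invT_gt0// mul0r.
have : ~~ (p0 i < dot (p i) z.1 < p1 i).
  by apply/negP => out; apply: zF; apply/interior_split_unionP; exists i.
have := hlt i; rewrite negb_and -!leNgt => ? /orP[|] ?; nra.
Qed.

End SplitCuts.

Theorem corollary4p4 (R : realType) (n k : nat)
    (A : 'M[R]_n) (c : 'cV[R]_n)
    (p : 'I_k -> 'cV[R]_n) (p0 p1 : 'I_k -> R)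
    (hA : A \in unitmx) (hk : (1 <= k)%N)
    (hp : forall i, p i != 0)
    (horth : forall i j, i != j -> dot (invT A *m p i) (invT A *m p j) = 0)
    (hlt : forall i, p0 i < p1 i) :
  convex_hull (paraboloid A c `\` interior (split_union p p0 p1)) =
  paraboloid A c `&` cut_set A c p p0 p1.
Proof.
(* The empty index set already gives the inequality of Q. *)
have -> : paraboloid A c `&` cut_set A c p p0 p1 = cut_set A c p p0 p1.
  by apply: setIidr; exact: cut_set_sub_paraboloid.
apply/seteqP; split.
  by apply: smallest_sub; [exact: convex_cut_set|exact: sub_cut_set].
by move=> z zC M [Mconv SM]; exact: (cut_set_sub_convex hA hp horth hlt Mconv SM).
Qed.
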